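(* Let $R$ be a unital ring with involution $\ast$, let $a\in R$, let $e\in R$ be an invertible Hermitian element, and let $n\geqslant 1$ be a positive integer. The following statements are equivalent: (i) $a$ is $e$-core invertible; (ii) there exists a unique idempotent $p\in R$ such that $(ep)^{\ast}=ep$, $pa=0$ and $u=a^{n}+p\in R^{-1}$; (iii) there exists an element $s\in R$ such that $(es)^{\ast}=es$, $sa=0$ and $v=a^{n}+s\in R^{-1}$; (iv) there exists a unique idempotent $q\in R$ such that $(eq)^{\ast}=eq$, $qa=0$ and $w=a^{n}(1-q)+q\in R^{-1}$; (v) there exists an element $t\in R$ such that $(et)^{\ast}=et$, $ta=0$ and $z=a^{n}(1-t)+t\in R^{-1}$. In this case, with $p,u$, $s,v$, $q,w$, $t,z$ as in (ii)–(v), the $e$-core inverse $a^{e,\mathrm{core}}$ of $a$ is given as follows: when $n=1$, $$a^{e,\mathrm{core}}=u^{-1}(1-p)=v^{-1}av^{-1}=(1-q)w^{-1}=z^{-1}a(1-t)z^{-1},$$ and when $n\geqslant 2$, $$a^{e,\mathrm{core}}=a^{n-1}u^{-1}=a^{n-1}v^{-1}=a^{n-1}(1-q)w^{-1}=a^{n-1}(1-t)z^{-1}.$$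
   Context: An involution $\ast$ on a unital ring $R$ is a map $R\to R$ satisfying $(x^{\ast})^{\ast}=x$, $(x+y)^{\ast}=x^{\ast}+y^{\ast}$ and $(xy)^{\ast}=y^{\ast}x^{\ast}$ for all $x,y\in R$. An element $x$ is Hermitian if $x^{\ast}=x$ and idempotent if $x^{2}=x$. $R^{-1}$ denotes the set of invertible elements of $R$. For $b\in R$, $bR=\{bx : x\in R\}$ and $Rb=\{xb : x\in R\}$. Let $e\in R$ be an invertible Hermitian element. An element $a\in R$ is $e$-core invertible if there exists $x\in R$ with $axa=a$, $xR=aR$ and $Rx=Ra^{\ast}e$; such an $x$ is unique if it exists, is called the $e$-core inverse of $a$, and is denoted $a^{e,\mathrm{core}}$. *)

(* Defs.v *)
From mathcomp Require Import all_boot all_algebra.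
From mathcomp Require Import classical_sets.
Set Implicit Arguments.
Unset Strict Implicit.
Unset Printing Implicit Defensive.
Import GRing.Theory.
Local Open Scope classical_set_scope.
Local Open Scope ring_scope.

(* [pzRingType] is the class of all unital, not necessarily commutative rings,
   the zero ring included.  [unitRingType] is avoided because it requires
   1 != 0; two-sided inverses are therefore given by a relation, in which the
   inverse is unique. *)
Definition inverse_of (R : pzRingType) (x y : R) : Prop :=
  x * y = 1 /\ y * x = 1.

Definition invertible (R : pzRingType) (x : R) : Prop :=
  exists y, inverse_of x y.

Definition idempotent_elt (R : pzRingType) (x : R) : Prop := x ^+ 2 = x.

Definition ring_involution (R : pzRingType) (star : R -> R) : Prop :=
  [/\ forall x, star (star x) = x,
      forall x y, star (x + y) = star x + star y
    & forall x y, star (x * y) = star y * star x].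

Definition hermitian_elt (R : pzRingType) (star : R -> R) (x : R) : Prop :=
  star x = x.

Definition right_principal (R : pzRingType) (b : R) : set R :=
  [set b * x | x in [set: R]].

Definition left_principal (R : pzRingType) (b : R) : set R :=
  [set x * b | x in [set: R]].

Definition ecore_inverse (R : pzRingType) (star : R -> R) (e a x : R) : Prop :=
  [/\ a * x * a = a,
      right_principal x = right_principal a
    & left_principal x = left_principal (star a * e)].

Definition ecore_invertible (R : pzRingType) (star : R -> R) (e a : R) : Prop :=
  exists x, ecore_inverse star e a x.

(* Main.v *)
Require Import Defs.
From mathcomp Require Import all_boot all_algebra.
From mathcomp Require Import classical_sets.
Set Implicit Arguments.
Unset Strict Implicit.
Unset Printing Implicit Defensive.
Import GRing.Theory.
Local Open Scope ring_scope.

(** Everything rests on an equational description of the [e]-core inverse: [x]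
is the [e]-core inverse of [a] exactly when [a x a = a], [x a x = x],
[x a^2 = a], [a x^2 = x] and [e a x] is Hermitian ([ecore_inverseP]).  So [a x]
is an idempotent with range [a R], self-adjoint for the twisted involution
[y |-> e^-1 y^* e], and such an idempotent is determined by its range.

If [x] exists, then [p = 1 - a x] annihilates [a] on the left, and as [x^n] is
the [e]-core inverse of [a^n], with [a^n x^n = a x], explicit inverses of
[a^n + p] and [a^n (1 - p) + p] can be written down.  An idempotent making
either element invertible is unique, for any two of them absorb each other and
are self-adjoint ([absorbing_projections_eq]).

For the way back, [a^n + s] and [a^n (1 - t) + t] are the cases [k = 0] and
[k = 1] of [v = a^n (1 - k s) + s].  From [s a = 0] one gets [s v = s^2], hence
[s = s^2 v^-1], and the twisted involution turns this into [s = h s^2] with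
[h = e^-1 (v^-1)^* e].  Thus [s] is group invertible, and
[p = s v^-1 = h s] is a self-adjoint idempotent with [p a = 0] and
[a^n (1 - k s) v^-1 = 1 - p].  Multiplication by [a] is injective on
[(1 - p) R], because there [v] acts as [a^n] ([eq0_of_annihilated]).  It follows
that [x = a^(n-1) (1 - k s) v^-1 (1 - p)] is the [e]-core inverse
([core_of_inverse]), and every formula of the theorem is a simplification of
this single expression. *)

(** * Rings with a weighted involution *)

Section WeightedInvolution.

Variables (R : pzRingType) (star : R -> R) (e d : R).
Hypotheses (star_inv : ring_involution star) (ed : inverse_of e d).
Hypothesis e_herm : hermitian_elt star e.

Local Notation eherm y := (hermitian_elt star (e * y)).

Lemma starM x y : star (x * y) = star y * star x.
Proof. by case: star_inv. Qed.

Lemma starB x y : star (x - y) = star x - star y.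
Proof.
case: star_inv => _ sD _; apply: (addIr (star y)).
by rewrite -sD !subrK.
Qed.

(** Self-adjointness for [y |-> d * star y * e], in a form free of [d]. *)
Lemma ehermE y : eherm y <-> star y * e = e * y.
Proof. by rewrite /hermitian_elt starM e_herm. Qed.

Lemma weight_inj x y : e * x = e * y -> x = y.
Proof.
case: ed => _ de exy.
by rewrite -[x]mul1r -[y]mul1r -de -!mulrA exy.
Qed.

Lemma eherm_compl y : eherm y -> eherm (1 - y).
Proof. by move=> hy; rewrite /hermitian_elt mulrBr mulr1 starB e_herm hy. Qed.

(** Taking adjoints in [q = q * p] gives [q = p * q], which is [p]. *)
Lemma absorbing_projections_eq p q :
  eherm p -> eherm q -> q = q * p -> p = p * q -> p = q.
Proof.
move=> /ehermE hp /ehermE hq qp pq; apply: weight_inj.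
by rewrite -hq qp starM -mulrA hq mulrA hp -mulrA -pq.
Qed.

(** * Equational form of the weighted core inverse *)

Definition core_eqs (a x : R) : Prop :=
  [/\ a * x * a = a, x * a * x = x, x * a * a = a, a * x * x = x
    & eherm (a * x)].

Lemma right_principalS (b c : R) : right_principal b = right_principal c ->
  exists y, b = c * y.
Proof.
move=> bc; have : right_principal b b by exists 1; rewrite ?mulr1.
by rewrite bc => -[y _ <-]; exists y.
Qed.

Lemma left_principalS (b c : R) : left_principal b = left_principal c ->
  exists y, b = y * c.
Proof.
move=> bc; have : left_principal b b by exists 1; rewrite ?mul1r.
by rewrite bc => -[y _ <-]; exists y.
Qed.

Lemma eq_right_principal (b c y z : R) : b = c * y -> c = b * z ->
  right_principal b = right_principal c.
Proof.
move=> bE cE; apply/seteqP; split=> _ [t _ <-].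
  by exists (y * t); rewrite // mulrA -bE.
by exists (z * t); rewrite // mulrA -cE.
Qed.

Lemma eq_left_principal (b c y z : R) : b = y * c -> c = z * b ->
  left_principal b = left_principal c.
Proof.
move=> bE cE; apply/seteqP; split=> _ [t _ <-].
  by exists (t * y); rewrite // -mulrA -bE.
by exists (t * z); rewrite // -mulrA -cE.
Qed.

(** Writing [x = y * (star a * e)] and substituting [star a] from
[a = a * x * a] yields [x = x * d * star (e * a * x)].  Hence [e * a * x] has
the form [f * d * star f] with [f = e * a * x], which is Hermitian. *)
Lemma ecore_inverseP a x : ecore_inverse star e a x <-> core_eqs a x.
Proof.
have [sK _ _] := star_inv; have [e_d d_e] := ed.
split=> [[axa xRa Rxa] | [axa xax xaa axx hax]].
  have [c xE] := right_principalS xRa.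
  have [b aE] := right_principalS (esym xRa).
  have [y xEy] := left_principalS Rxa.
  have saxa : star a * star (e * (a * x)) = star a * e.
    by rewrite -{3}axa !starM e_herm !mulrA.
  have xd : x * d = y * star a by rewrite xEy -!mulrA e_d mulr1.
  have xf : x = x * d * star (e * (a * x)) by rewrite xd -mulrA saxa.
  have star_d : star d = d.
    apply: weight_inj; rewrite e_d.
    have s1 : star 1 = 1 by have := starM (star 1) 1; rewrite mulr1 !sK mulr1.
    by rewrite -[X in X * _]e_herm -starM d_e s1.
  have hax : eherm (a * x).
    have fE : e * (a * x) = e * (a * x) * d * star (e * (a * x)).
      by rewrite {1}xf !mulrA.
    move: (e * (a * x)) fE => f fE.
    by rewrite /hermitian_elt {1}fE !starM star_d sK mulrA -fE.
  have xax : x * a * x = x.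
    by rewrite [RHS]xf hax -[x * d * _]mulrA [d * (e * _)]mulrA d_e mul1r mulrA.
  split=> //; first by rewrite {2}aE mulrA xax -aE.
  by rewrite {2 3}xE mulrA axa.
move/ehermE: (hax) => hax'; split=> //.
  by apply: (@eq_right_principal _ _ (x * x) (a * a)); rewrite mulrA.
apply: (@eq_left_principal _ _ (x * d * star x) (star a * e * a)).
  rewrite -[x * d * star x * _]mulrA [star x * _]mulrA -starM hax'.
  by rewrite -mulrA [d * _]mulrA d_e mul1r mulrA.
by rewrite -{1}axa starM -mulrA hax' !mulrA.
Qed.

(** Both [a * x] and [a * y] have range [a R], hence they coincide. *)
Lemma core_unique a x y : core_eqs a x -> core_eqs a y -> x = y.
Proof.
move=> [axa xax xaa axx hx] [aya yay yaa ayy hy].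
have compl_absorb b c : a * b * a = a -> 1 - a * b = (1 - a * b) * (1 - a * c).
  by move=> aba; rewrite [RHS]mulrBr mulr1 mulrBl mul1r mulrA aba subrr subr0.
have axy : a * x = a * y.
  apply/oppr_inj/(addrI 1)/absorbing_projections_eq; try exact: eherm_compl.
    exact: compl_absorb aya.
  exact: compl_absorb axa.
by rewrite -xax -mulrA axy -{1}ayy !mulrA xaa ayy.
Qed.

(** * From a core inverse to projections *)

Section FromCoreInverse.

Variables (a x : R).
Hypothesis ax_core : core_eqs a x.

Lemma core_expr_mul n : a ^+ n.+1 * x ^+ n.+1 = a * x.
Proof.
have [_ _ _ axx _] := ax_core.
elim: n => // n IHn; rewrite exprSr [x ^+ _]exprS [x ^+ n.+1]exprS.
by rewrite -mulrA [a * (x * _)]mulrA [a * x * (x * _)]mulrA axx -exprS IHn.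
Qed.

(** The idempotent [a * x] is shared by all the powers of [a]. *)
Lemma core_expr n : core_eqs (a ^+ n.+1) (x ^+ n.+1).
Proof.
have [axa xax xaa axx hax] := ax_core.
have absorb m : x ^+ m * a ^+ (m + n.+1) = a ^+ n.+1.
  elim: m => [|m IHm]; first by rewrite mul1r.
  rewrite exprSr addSn addnS [a ^+ (m + n).+2]exprS [a ^+ (m + n).+1]exprS.
  by rewrite -mulrA [x * (a * _)]mulrA [x * a * (a * _)]mulrA xaa -exprS -addnS.
split; rewrite ?core_expr_mul //.
- by rewrite exprS mulrA axa.
- by rewrite -mulrA core_expr_mul exprSr -!mulrA [x * (a * x)]mulrA xax.
- by rewrite -mulrA -exprD absorb.
- by rewrite exprS mulrA axx.
Qed.

End FromCoreInverse.

(** The inverse is [x + (1 - x * a)]: [x] undoes [a] on [a R], while [1 - a * x]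
and [1 - x * a] are mutually inverse between the kernels of [a] and [a * x]. *)
Lemma core_sum_invertible a x :
  core_eqs a x -> invertible (a + (1 - a * x)).
Proof.
move=> [axa xax xaa axx _]; exists (x + (1 - x * a)).
have a_kill : a * (1 - x * a) = 0 by rewrite mulrBr mulr1 mulrA axa subrr.
have kill_x : (1 - a * x) * x = 0 by rewrite mulrBl mul1r axx subrr.
have x_kill : x * (1 - a * x) = 0 by rewrite mulrBr mulr1 mulrA xax subrr.
have kill_a : (1 - x * a) * a = 0 by rewrite mulrBl mul1r xaa subrr.
split.
  rewrite mulrDl 2![_ * (x + _)]mulrDr a_kill kill_x addr0 add0r.
  by rewrite mulrBr mulrA kill_x mul0r subr0 mulr1 addrC subrK.
rewrite mulrDl 2![_ * (a + _)]mulrDr x_kill kill_a addr0 add0r.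
by rewrite mulrBr mulrA kill_a mul0r subr0 mulr1 addrC subrK.
Qed.

(** On [a R] this element acts as [a], with inverse [x], and on the kernel of
[a * x] as the identity. *)
Lemma core_corner_invertible a x :
  core_eqs a x -> invertible (a * (a * x) + (1 - a * x)).
Proof.
move=> [axa xax xaa axx _]; exists (x + (1 - a * x)).
have idem : a * x * (1 - a * x) = 0 by rewrite mulrBr mulr1 mulrA axa subrr.
have idem' : (1 - a * x) * (1 - a * x) = 1 - a * x.
  by rewrite [LHS]mulrBl mul1r idem subr0.
have kill_x : (1 - a * x) * x = 0 by rewrite mulrBl mul1r axx subrr.
have x_kill : x * (1 - a * x) = 0 by rewrite mulrBr mulr1 mulrA xax subrr.
have kill_a : (1 - a * x) * (a * (a * x)) = 0.
  have kill : (1 - a * x) * a = 0 by rewrite mulrBl mul1r axa subrr.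
  by rewrite [LHS]mulrA kill mul0r.
split.
  rewrite mulrDl 2![_ * (x + _)]mulrDr idem' kill_x.
  rewrite -[a * _ * x]mulrA axx -[a * _ * _]mulrA idem mulr0.
  by rewrite addr0 add0r addrC subrK.
rewrite mulrDl 2![_ * (_ * _ + _)]mulrDr idem'.
rewrite kill_a [x * (a * _)]mulrA [x * a * _]mulrA xaa x_kill.
by rewrite addr0 add0r addrC subrK.
Qed.

(** * From an invertible sum to the core inverse *)

Section FromInvertibleSum.

Variables (a s k g : R) (m : nat).
Hypotheses (s_herm : eherm s) (sa : s * a = 0).
Hypothesis vg : inverse_of (a ^+ m.+1 * (1 - k * s) + s) g.

Local Notation b := (1 - k * s).
Local Notation v := (a ^+ m.+1 * b + s).
Local Notation p := (s * g).

Lemma sum_mulV : v * g = 1. Proof. by case: vg. Qed.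

Lemma annihilator_sum : s * v = s * s.
Proof. by rewrite mulrDr exprS !mulrA sa !mul0r add0r. Qed.

Lemma annihilator_proj : s * p = s.
Proof. by rewrite mulrA -annihilator_sum -mulrA sum_mulV mulr1. Qed.

(** The adjoint of [s = s * s * g] for the twisted involution. *)
Lemma adjoint_mul_sqr : d * star g * e * s * s = s.
Proof.
have [e_d d_e] := ed; move/ehermE: s_herm => hs.
apply: weight_inj; rewrite -!mulrA [e * (d * _)]mulrA e_d mul1r.
rewrite [e * (s * s)]mulrA -hs -[star s * e * s]mulrA -hs.
by rewrite !mulrA -!starM annihilator_proj.
Qed.

Lemma projE : p = d * star g * e * s.
Proof. by rewrite -{1}adjoint_mul_sqr -!mulrA annihilator_proj. Qed.

Lemma proj_annihilator : p * s = s.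
Proof. by rewrite projE adjoint_mul_sqr. Qed.

Lemma proj_idem : p * p = p.
Proof. by rewrite mulrA proj_annihilator. Qed.

Lemma compl_idem : (1 - p) * (1 - p) = 1 - p.
Proof. by rewrite [LHS]mulrBr mulr1 mulrBl mul1r proj_idem subrr subr0. Qed.

Lemma proj_mul : p * a = 0.
Proof. by rewrite projE -mulrA sa mulr0. Qed.

Lemma proj_eherm : eherm p.
Proof.
have [e_d _] := ed; move/ehermE: s_herm => hs; apply/ehermE.
by rewrite starM -mulrA hs projE !mulrA e_d mul1r.
Qed.

Lemma expr_factor_inv : a ^+ m.+1 * b * g = 1 - p.
Proof. by apply: (addIr p); rewrite subrK -mulrDl sum_mulV. Qed.

(** On [(1 - p) R] the invertible [v] acts as [a ^+ m.+1]. *)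
Lemma eq0_of_annihilated y : p * y = 0 -> a * y = 0 -> y = 0.
Proof.
move=> py ay; have [_ gv] := vg.
have sy : s * y = 0 by rewrite -annihilator_proj -mulrA py mulr0.
have by_y : b * y = y by rewrite mulrBl mul1r -mulrA sy mulr0 subr0.
rewrite -[y]mul1r -gv -mulrA mulrDl -mulrA by_y sy exprSr -mulrA ay.
by rewrite mulr0 addr0 mulr0.
Qed.

(** With [p = h * s] as in [projE], one has [p * g = h * p]: the inverse [g]
maps the kernel of [p], which contains [a], into itself. *)
Lemma annihilator_inv_mul : s * g * g * a = 0.
Proof.
by rewrite projE -[_ * s * g]mulrA -mulrA proj_mul mulr0.
Qed.

Lemma annihilator_inv_compl : s * (g * (1 - p)) = 0.
Proof.
have sga : s * g * a = 0 by exact: proj_mul.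
by rewrite mulrA -expr_factor_inv exprS !mulrA sga !mul0r.
Qed.

(** As [a * sum_core = 1 - p] has to hold, the factor [1 - p] on the right is
what makes [x * a * x = x] true; for [m > 0] it can be dropped ([sum_coreS]). *)
Definition sum_core : R := a ^+ m * b * g * (1 - p).

Lemma factor_inv_compl : b * g * (1 - p) = g * (1 - p).
Proof.
by rewrite -mulrA mulrBl mul1r -mulrA annihilator_inv_compl mulr0 subr0.
Qed.

Lemma mul_sum_core : a * sum_core = 1 - p.
Proof. by rewrite /sum_core !mulrA -exprS expr_factor_inv compl_idem. Qed.

Lemma proj_sum_core : p * sum_core = 0.
Proof.
rewrite /sum_core; case: m expr_factor_inv => [|j] abg; last first.
  by rewrite exprS !mulrA proj_mul !mul0r.
rewrite mul1r factor_inv_compl -abg expr1 !mulrA.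
by rewrite annihilator_inv_mul !mul0r.
Qed.

(** The one equation not read off from [a * x = 1 - p] is [x * a * a = a]; both
sides lie in the kernel of [p] and agree after multiplication by [a]. *)
Lemma core_of_inverse : core_eqs a sum_core.
Proof.
have compl_a : (1 - p) * a = a by rewrite mulrBl mul1r proj_mul subr0.
have core_compl : sum_core * (1 - p) = sum_core.
  by rewrite /sum_core -mulrA compl_idem.
move: sum_core mul_sum_core proj_sum_core core_compl => x ax px x_compl.
split; rewrite ?ax //.
- by rewrite -mulrA ax.
- apply/subr0_eq/eq0_of_annihilated; rewrite mulrBr !mulrA.
    by rewrite px !mul0r proj_mul subr0.
  by rewrite ax compl_a subrr.
- by rewrite mulrBl mul1r px subr0.
- exact/eherm_compl/proj_eherm.
Qed.

Lemma sum_core1 : m = 0%N -> sum_core = g * (1 - p).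
Proof. by move=> m0; rewrite /sum_core m0 mul1r factor_inv_compl. Qed.

(** For [m > 0] the element [a ^+ m * b * g * p] lies in [a R], hence in the
kernel of [p], and [a] kills it. *)
Lemma sum_coreS : (0 < m)%N -> sum_core = a ^+ m * b * g.
Proof.
move=> m_gt0; rewrite /sum_core mulrBr mulr1.
suff -> : a ^+ m * b * g * p = 0 by rewrite subr0.
apply: eq0_of_annihilated.
  by rewrite -(prednK m_gt0) exprS !mulrA proj_mul !mul0r.
by rewrite !mulrA -exprS expr_factor_inv -mulrA mulrBl mul1r proj_idem subrr.
Qed.

Lemma idem_mul_inv : idempotent_elt s -> p = s.
Proof.
move=> s2; rewrite -{1}s2 expr2 -annihilator_sum -mulrA.
by rewrite sum_mulV mulr1.
Qed.

Lemma left_annihilator_absorb q : idempotent_elt s -> q * a = 0 -> q = q * s.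
Proof.
move=> s2 qa; rewrite -{1}[q]mulr1 -sum_mulV mulrA mulrDr exprS !mulrA qa.
by rewrite !mul0r add0r -mulrA idem_mul_inv.
Qed.

End FromInvertibleSum.

Lemma projection_unique (a k l p q g h : R) m :
  inverse_of (a ^+ m.+1 * (1 - k * p) + p) g ->
  inverse_of (a ^+ m.+1 * (1 - l * q) + q) h ->
  idempotent_elt p -> eherm p -> p * a = 0 ->
  idempotent_elt q -> eherm q -> q * a = 0 -> p = q.
Proof.
move=> pg qh p2 hp pa q2 hq qa; apply: absorbing_projections_eq => //.
  exact: (left_annihilator_absorb pa pg).
exact: (left_annihilator_absorb qa qh).
Qed.

(** Keeping [f] abstract covers the two shapes [a ^+ n + p] and
[a ^+ n * (1 - p) + p] at once. *)
Lemma core_projection_exists_unique (a x k : R) m (f : R -> R) :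
  (forall p, a ^+ m.+1 * (1 - k * p) + p = f p) ->
  core_eqs a x -> invertible (f (1 - a * x)) ->
  exists! p, [/\ idempotent_elt p, eherm p, p * a = 0 & invertible (f p)].
Proof.
move=> fE [axa _ _ _ hax] f_inv; have [g fg] := f_inv.
have hp := eherm_compl hax.
have pa : (1 - a * x) * a = 0 by rewrite mulrBl mul1r axa subrr.
have p2 : idempotent_elt (1 - a * x).
  by rewrite /idempotent_elt expr2 mulrBr mulr1 mulrA pa mul0r subr0.
exists (1 - a * x); split=> // q [q2 hq qa [h fh]].
by apply: (@projection_unique a k k _ q g h m) => //; rewrite fE.
Qed.

End WeightedInvolution.


Theorem theorem2p2 (R : pzRingType) (star : R -> R) (a e : R) (n : nat)
    (star_inv : ring_involution star)
    (e_inv : invertible e) (e_herm : hermitian_elt star e)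
    (n_ge1 : (1 <= n)%N) :
  [<-> ecore_invertible star e a;
       exists! p : R,
         [/\ idempotent_elt p, hermitian_elt star (e * p), p * a = 0
           & invertible (a ^+ n + p)];
       exists s : R,
         [/\ hermitian_elt star (e * s), s * a = 0
           & invertible (a ^+ n + s)];
       exists! q : R,
         [/\ idempotent_elt q, hermitian_elt star (e * q), q * a = 0
           & invertible (a ^+ n * (1 - q) + q)];
       exists t : R,
         [/\ hermitian_elt star (e * t), t * a = 0
           & invertible (a ^+ n * (1 - t) + t)]]
  /\
  (forall x : R, ecore_inverse star e a x ->
    [/\ forall p u' : R,
          idempotent_elt p -> hermitian_elt star (e * p) -> p * a = 0 ->
          inverse_of (a ^+ n + p) u' ->
          (n = 1%N -> x = u' * (1 - p)) /\
          ((2 <= n)%N -> x = a ^+ (n - 1) * u'),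
        forall s v' : R,
          hermitian_elt star (e * s) -> s * a = 0 ->
          inverse_of (a ^+ n + s) v' ->
          (n = 1%N -> x = v' * a * v') /\
          ((2 <= n)%N -> x = a ^+ (n - 1) * v'),
        forall q w' : R,
          idempotent_elt q -> hermitian_elt star (e * q) -> q * a = 0 ->
          inverse_of (a ^+ n * (1 - q) + q) w' ->
          (n = 1%N -> x = (1 - q) * w') /\
          ((2 <= n)%N -> x = a ^+ (n - 1) * (1 - q) * w')
      & forall t z' : R,
          hermitian_elt star (e * t) -> t * a = 0 ->
          inverse_of (a ^+ n * (1 - t) + t) z' ->
          (n = 1%N -> x = z' * a * (1 - t) * z') /\
          ((2 <= n)%N -> x = a ^+ (n - 1) * (1 - t) * z')]).
Proof.
case: n n_ge1 => // m _; have [d ed] := e_inv.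
have coreP := ecore_inverseP star_inv ed e_herm.
have sumE s : a ^+ m.+1 * (1 - 0 * s) + s = a ^+ m.+1 + s.
  by rewrite mul0r subr0 mulr1.
have cornerE s : a ^+ m.+1 * (1 - 1 * s) + s = a ^+ m.+1 * (1 - s) + s.
  by rewrite mul1r.
have invertible_core s k : hermitian_elt star (e * s) -> s * a = 0 ->
    invertible (a ^+ m.+1 * (1 - k * s) + s) -> ecore_invertible star e a.
  move=> hs sa [g vg]; exists (sum_core a s k g m); apply/coreP.
  exact: (core_of_inverse star_inv ed e_herm hs sa vg).
have formulas s k g x : ecore_inverse star e a x ->
    hermitian_elt star (e * s) -> s * a = 0 ->
    inverse_of (a ^+ m.+1 * (1 - k * s) + s) g -> x = sum_core a s k g m.
  move=> /coreP ax hs sa vg; apply: (core_unique star_inv ed e_herm ax).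
  exact: (core_of_inverse star_inv ed e_herm hs sa vg).
split.
  tfae.
  - move=> [x /coreP ax].
    apply: (core_projection_exists_unique star_inv ed e_herm sumE ax).
    rewrite -(core_expr_mul ax m).
    exact: core_sum_invertible (core_expr ax m).
  - by move=> [p [[_ hp pa up] _]]; exists p.
  - move=> [s [hs sa vs]].
    have [|x /coreP ax] := invertible_core s 0 hs sa; first by rewrite sumE.
    apply: (core_projection_exists_unique star_inv ed e_herm cornerE ax).
    rewrite subKr -(core_expr_mul ax m).
    exact: core_corner_invertible (core_expr ax m).
  - by move=> [q [[_ hq qa wq] _]]; exists q.
  - by move=> [t [ht ta zt]]; apply: (invertible_core t 1); rewrite ?cornerE.
move=> x ax; rewrite subn1 /=; split.
- move=> p g p2 hp pa; rewrite -sumE => vg.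
  rewrite (formulas _ _ _ _ ax hp pa vg) -[in 1 - p](idem_mul_inv pa vg p2).
  split=> [[m0] | m_gt0]; first exact: (sum_core1 star_inv ed e_herm hp pa vg).
  by rewrite (sum_coreS star_inv ed e_herm hp pa vg) // mul0r subr0 mulr1.
- move=> s g hs sa; rewrite -sumE => vg.
  rewrite (formulas _ _ _ _ ax hs sa vg).
  split=> [[m0] | m_gt0].
    rewrite (sum_core1 star_inv ed e_herm hs sa vg m0) -(expr_factor_inv vg) m0.
    by rewrite mul0r subr0 mulr1 mulrA.
  by rewrite (sum_coreS star_inv ed e_herm hs sa vg) // mul0r subr0 mulr1.
- move=> q g q2 hq qa; rewrite -cornerE => vg.
  rewrite (formulas _ _ _ _ ax hq qa vg).
  split=> [[m0] | m_gt0].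
    have [_ gw] := vg; rewrite mul1r in gw.
    (* [w * q = q], so the factor [1 - q * g] of [sum_core] is absorbed. *)
    have gq : g * q = q.
      have wq : (a ^+ m.+1 * (1 - q) + q) * q = q.
        by rewrite mulrDl -mulrA mulrBl mul1r -expr2 q2 subrr mulr0 add0r.
      by rewrite -{1}wq mulrA gw mul1r.
    rewrite /sum_core m0 !mul1r (idem_mul_inv qa vg q2) mulrBr mulr1.
    rewrite -[X in _ - X]mulrA gq [(1 - q) * q]mulrBl mul1r -expr2 q2.
    by rewrite subrr subr0.
  by rewrite (sum_coreS star_inv ed e_herm hq qa vg) // mul1r.
- move=> t g ht ta; rewrite -cornerE => vg.
  rewrite (formulas _ _ _ _ ax ht ta vg).
  split=> [[m0] | m_gt0].
    rewrite (sum_core1 star_inv ed e_herm ht ta vg m0) -(expr_factor_inv vg) m0.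
    by rewrite mul1r !mulrA.
  by rewrite (sum_coreS star_inv ed e_herm ht ta vg) // mul1r.
Qed.
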